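(* Let $G$ be a finite group, $S$ a Sylow $2$-subgroup of $G$, and $D$ an abelian $2$-group on which $G$ acts faithfully. Assume that $G$ has a minimal nontrivial offender on $D$ (minimal under inclusion among nontrivial offenders) that is not solitary, i.e. is not a member of $\mathcal{T}_D(G)$. Then there is a nonidentity subgroup $J\leq S$, generated by offenders on $D$ and weakly closed in $S$ with respect to $G$, such that $C_D(N_G(J))=C_D(G)$.
   Context: All groups are finite. For a prime $p$ and a group $G$ acting faithfully on an abelian $p$-group $D$, an abelian $p$-subgroup $A\leq G$ is an offender on $D$ if $|A||C_D(A)|\geq |D|$, and a best offender if $|A||C_D(A)|\geq |B||C_D(B)|$ for every subgroup $B\leq A$; it is nontrivial if $A\neq 1$. $\mathcal{A}_D(G)$ is the set of nontrivial best offenders in $G$ on $D$, and $\mathcal{A}_D(G)_2$ is the set of members of $\mathcal{A}_D(G)$ of order $2$. For a set $\mathcal{A}$ of subgroups of $G$ and $H\leq G$, $\mathcal{A}\cap H=\{A\in\mathcal{A}\mid A\leq H\}$. Solitary offenders ($p=2$): let $S$ be a Sylow $2$-subgroup of $G$, $\mathcal{A}=\mathcal{A}_D(G)_2$, $J_0=\langle\mathcal{A}\cap S\rangle$, and $T\in\mathcal{A}\cap S$. $T$ is solitary in $G$ relative to $S$ if there is a subgroup $L\leq G$ containing $T$ such that (S1) $L\cong S_3$; (S2) $J_0=T\times C_{J_0}(L)$ and $C_{J_0}(L)=\langle(\mathcal{A}\cap S)-\{T\}\rangle$; (S3) $D=[D,L]\times C_D(L)$ and $[D,L,C_{J_0}(L)]=1$.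 $\mathcal{T}_D(G)$ is the collection of subgroups of $G$ that are solitary in $G$ relative to some Sylow $2$-subgroup of $G$. $J\leq S$ is weakly closed in $S$ with respect to $G$ if $J^g\leq S$ with $g\in G$ implies $J^g=J$. *)

(* Defs.v *)
From mathcomp Require Import all_boot all_fingroup all_solvable.

Set Implicit Arguments.
Unset Strict Implicit.
Unset Printing Implicit Defensive.

Import GroupScope.

(* G acts by automorphisms on D through to : groupAction G D, where D may live
   in a different ambient group. For A \subset G, C_D(A) is 'C_(|to)(A). *)

Section Offenders.

Variables (aT rT : finGroupType) (G : {group aT}) (D : {group rT}).
Variable to : groupAction G D.

(* [X, A] for X \subset D and A \subset G, taken in the semidirect product:
   [~ x, a] = x^-1 * x ^ a, where x ^ a is to x a. *)
Definition act_comm (X : {set rT}) (A : {set aT}) : {set rT} :=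
  <<[set x^-1 * to x a | x in X, a in A]>>.

Canonical act_comm_group X A := Eval hnf in [group of act_comm X A].

Definition offender (p : nat) (A : {group aT}) : bool :=
  [&& A \subset G, p.-group A, abelian A & #|D| <= #|A| * #|'C_(|to)(A)|].

Definition best_offender (p : nat) (A : {group aT}) : bool :=
  [&& A \subset G, p.-group A, abelian A &
      [forall B : {group aT}, (B \subset A) ==>
         (#|B| * #|'C_(|to)(B)| <= #|A| * #|'C_(|to)(A)|)]].

Definition min_nontrivial_offender (p : nat) (A : {group aT}) : bool :=
  [min A | offender p A & A :!=: 1].

Definition best_offenders (p : nat) : {set {group aT}} :=
  [set A : {group aT} | best_offender p A & A :!=: 1].

Definition best_offenders2 (p : nat) : {set {group aT}} :=
  [set A in best_offenders p | #|A| == 2].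

Definition fam_in (F : {set {group aT}}) (H : {set aT}) : {set {group aT}} :=
  [set A in F | A \subset H].

Definition fam_gen (F : {set {group aT}}) : {set aT} :=
  <<\bigcup_(A in F) A>>.

Canonical fam_gen_group F := Eval hnf in [group of fam_gen F].

Definition solitary_wrt (S T : {group aT}) : bool :=
  let AS := fam_in (best_offenders2 2) S in
  let J0 := fam_gen AS in
  (T \in AS) &&
  [exists L : {group aT},
    [&& L \subset G, T \subset L,
        L \isog 'Sym_('I_3),
        T \x 'C_J0(L) == J0,
        'C_J0(L) == fam_gen (AS :\ T),
        act_comm D L \x 'C_(|to)(L) == D
      & act_comm (act_comm D L) 'C_J0(L) == 1]].

Definition solitary_subgroups : {set {group aT}} :=
  [set T : {group aT} |
    [exists S : {group aT}, (2.-Sylow(G) S) && solitary_wrt S T]].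

End Offenders.

Definition weakly_closed (gT : finGroupType) (J S G : {set gT}) : Prop :=
  J \subset S /\ {in G, forall g, J :^ g \subset S -> J :^ g = J}.

(* Main.v *)
(* For v in C_D(N_G(J)), the product of the G-orbit of v is fixed by G. Since J
   is weakly closed, v is the only point of that orbit fixed by J, so it is
   enough to see that every nontrivial J-orbit in it has product in C_D(G). By
   induction on the order of v one may assume that v^2 is in C_D(G).

   If some nontrivial offender A is rigid, i.e. C_D(A0) = C_D(A) whenever
   |A : A0| = 2, let J be generated by the conjugates of A in S: each nontrivial
   J-orbit is a union of two halves with equal products, and its product is a power of
   v^2. Minimal offenders of order at least 4 are rigid, and so is the four-group
   generated by two transvections with the same axis.

   Otherwise the minimal offenders are generated by transvections, which are
   determined by their axes; this forces any two of them to commute or to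
   generate S_3. Let J be generated by the conjugates in S of the given
   transvection. The product of a J-orbit of length at least 4 is again a power
   of v^2, and a J-orbit of length 2 exhibits the transvection as solitary. *)

Require Import Defs.
From mathcomp Require Import all_boot all_fingroup all_solvable.
From mathcomp Require Import ssralg.
Import FiniteModule.

Set Implicit Arguments.
Unset Strict Implicit.
Unset Printing Implicit Defensive.

Import GroupScope.

(** * Preliminaries on groups *)

Lemma index2_rcoset (gT : finGroupType) (J M : {group gT}) a :
  M \subset J -> #|J : M| = 2 -> a \in J -> a \notin M -> J :\: M = M :* a.
Proof.
move=> sMJ iJM Ja nMa; apply/esym/eqP; rewrite eqEcard; apply/andP; split.
  apply/subsetP=> _ /rcosetP[m Mm ->].
  by rewrite inE groupMl // nMa groupM // (subsetP sMJ).
by rewrite card_rcoset cardsD (setIidPr sMJ) -(Lagrange sMJ) iJM muln2 -addnn addnK.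
Qed.

Lemma index2_capg (gT : finGroupType) (J M B : {group gT}) :
  B \subset J -> #|J : M| = 2 -> ~~ (B \subset M) -> #|B : B :&: M| = 2.
Proof.
move=> sBJ iJM nBM; apply/eqP; rewrite indexgI eqn_leq -{1}iJM.
rewrite subset_leq_card ?imsetS //= ltn_neqAle eq_sym indexg_eq1 nBM.
by rewrite indexg_gt0.
Qed.

(** The three relations make the group a quotient of ['D_6]; since it has elements of orders 2 and
    3, its order is at least 6. *)
Lemma S3_dihedral (gT : finGroupType) (x y : gT) :
  #[x] = 2 -> #[y] = 2 -> #[x * y] = 3 -> <<[set x; y]>> \isog 'D_6.
Proof.
move=> ox oy oxy; set L := <<_>>.
have Lx : x \in L by rewrite mem_gen ?set21.
have Ly : y \in L by rewrite mem_gen ?set22.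
rewrite isogEcard (@card_dihedral 3) //; apply/andP; split.
  rewrite (@Grp'_dihedral 3) //; apply/existsP; exists (x, y); rewrite /= !xpair_eqE.
  by rewrite joing_idl joing_idr -oxy -{1}ox -oy !expg_order !eqxx.
apply: dvdn_leq; first exact: cardG_gt0.
by rewrite (@Gauss_dvd 2 3) // -{1}ox -oxy !order_dvdG ?groupM.
Qed.

Lemma S3_Sym (gT : finGroupType) (x y : gT) :
  #[x] = 2 -> #[y] = 2 -> #[x * y] = 3 -> <<[set x; y]>> \isog 'Sym_('I_3).
Proof.
move=> ox oy oxy; apply: isog_trans (S3_dihedral ox oy oxy) _.
pose i0 : 'I_3 := @Ordinal 3 0 isT; pose i1 : 'I_3 := @Ordinal 3 1 isT.
pose i2 : 'I_3 := @Ordinal 3 2 isT.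
pose s := tperm i0 i1; pose t := tperm i1 i2.
have os : #[s] = 2.
  apply: nt_prime_order => //; first by rewrite expgS expg1 tperm2.
  by apply/eqP=> /permP/(_ i0); rewrite perm1 tpermL.
have ot : #[t] = 2.
  apply: nt_prime_order => //; first by rewrite expgS expg1 tperm2.
  by apply/eqP=> /permP/(_ i1); rewrite perm1 tpermL.
have ost : #[s * t] = 3.
  apply: nt_prime_order => //.
    apply/permP=> i; apply/val_inj.
    rewrite !expgS expg0 mulg1 !permM perm1.
    have: i \in [:: i0; i1; i2] by case: i => [[|[|[|]]]].
    by rewrite !inE => /or3P[] /eqP->; rewrite !permE /=.
  by apply/eqP=> /permP/(_ i0); rewrite perm1 permM !permE.
have isoSt := S3_dihedral os ot ost.
have defS : <<[set s; t]>> = 'Sym_('I_3).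
  apply/eqP; rewrite eqEcard subsetT cardsT card_Sn.
  by rewrite (card_isog isoSt) (@card_dihedral 3).
by rewrite defS in isoSt; rewrite isog_sym.
Qed.

(** * Control of fixed points by orbit products *)

Section GroupActionOnAbelian.

Variables (aT rT : finGroupType) (G : {group aT}) (D : {group rT}).
Variable to : groupAction G D.
Implicit Types (A M J S : {group aT}) (a g : aT) (u v w x z : rT).

Lemma gact_mem x g : g \in G -> x \in D -> to x g \in D.
Proof. by move=> Gg; rewrite (gact_stable to Gg). Qed.

Lemma gacentP (A : {set aT}) x :
  A \subset G -> reflect (x \in D /\ {in A, forall a, to x a = x}) (x \in 'C_(|to)(A)).
Proof.
move=> sAG; rewrite gacentE // inE.
apply: (iffP andP) => -[-> fx]; split=> //; first exact/afixP.
exact/afixP.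
Qed.

Hypothesis abelD : abelian D.

(** Products over an orbit make sense only by commutativity, so they are written as [\sum] in the
    additive copy of [D] given by [fmod abelD], and [val] brings them back to [D]. *)
Lemma gact_sum (O : {set rT}) g : g \in G -> O \subset D ->
  to (val (\sum_(x in O) fmod abelD x)%R) g
    = val (\sum_(x in O) fmod abelD (to x g))%R.
Proof.
move=> Gg sOD.
pose f (u : fmod_of abelD) := fmod abelD (to (val u) g).
have fD : {morph f : u v / (u + v)%R}.
  move=> u v; rewrite /f fmvalA gactM ?fmodP //.
  by rewrite fmodM ?gact_mem ?fmodP.
have f0 : f 0%R = 0%R by rewrite /f fmval0 gact1 // fmod1.
transitivity (val (f (\sum_(x in O) fmod abelD x)%R)).
  by rewrite fmodK // gact_mem ?fmodP.
congr val; rewrite (big_morph f fD f0); apply: eq_bigr => x Ox.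
by rewrite /f fmodK // (subsetP sOD).
Qed.

Lemma gact_sum_stable (O : {set rT}) g : g \in G -> O \subset D ->
    (forall x, x \in O -> to x g \in O) ->
  to (val (\sum_(x in O) fmod abelD x)%R) g = val (\sum_(x in O) fmod abelD x)%R.
Proof.
move=> Gg sOD Og; rewrite gact_sum //; congr val.
have injg : {in O &, injective (to^~ g)} by move=> x y _ _; apply: act_inj.
have defO : O = [set to x g | x in O].
  apply/esym/eqP; rewrite eqEcard card_in_imset // leqnn andbT.
  by apply/subsetP=> _ /imsetP[x Ox ->]; apply: Og.
by rewrite [in RHS]defO big_imset.
Qed.

Lemma orbit_sub_range (A : {set aT}) w :
  A \subset G -> w \in D -> orbit to A w \subset D.
Proof.
by move=> sAG Dw; apply/subsetP=> _ /imsetP[a Aa ->]; rewrite gact_mem ?(subsetP sAG).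
Qed.

Lemma astab1inE g x : g \in G -> (g \in 'C[x | to]) = (to x g == x).
Proof. by move=> Gg; rewrite !inE Gg sub1set ?inE. Qed.

Lemma weakly_closed_sub_norm J S :
  S \subset G -> weakly_closed J S G -> S \subset 'N_G(J).
Proof.
move=> sSG [sJS wcJ]; rewrite subsetI sSG; apply/subsetP=> s Ss.
by rewrite inE wcJ ?subxx ?(subsetP sSG) // -(conjGid Ss) conjSg.
Qed.

(** Both [S], which normalizes [J], and [J :^ g^-1] fix [v]. By Sylow in the stabilizer of [v], some
    [k] fixing [v] carries [J :^ g^-1] into [S]. Weak closure puts [g^-1 * k] in ['N_G(J)], so it
    fixes [v], and hence so does [g]. *)
Lemma weakly_closed_fixed_conjugate (p : nat) S J g v :
    p.-Sylow(G) S -> weakly_closed J S G -> v \in 'C_(|to)('N_G(J)) ->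
    g \in G -> {in J, forall b, to (to v g) b = to v g} ->
  to v g = v.
Proof.
move=> sylS [sJS wcJ] Cv Gg fJ.
have sSG : S \subset G := pHall_sub sylS.
have sJG := subset_trans sJS sSG.
have [Dv fv] := gacentP v (subsetIl G 'N(J)) Cv.
have sSK : S \subset 'C_G[v | to].
  apply/subsetP=> s Ss; have Gs := subsetP sSG s Ss.
  have NJs := subsetP (weakly_closed_sub_norm sSG (conj sJS wcJ)) s Ss.
  by rewrite inE Gs astab1inE // (fv s NJs) eqxx.
have sylSK := pHall_subl sSK (subsetIl _ _) sylS.
have sJgK : (J :^ g^-1)%G \subset 'C_G[v | to].
  apply/subsetP=> _ /imsetP[b Jb ->]; have Gb := subsetP sJG b Jb.
  have Gbg : b ^ g^-1 \in G by rewrite groupJ ?groupV.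
  rewrite inE Gbg astab1inE // conjgE invgK !actMin ?groupM ?groupV //.
  by rewrite fJ //= -actMin ?groupV // mulgV act1.
have pJg : p.-group (J :^ g^-1)%G.
  by rewrite pgroupJ (pgroupS sJS) // (pHall_pgroup sylS).
have [k /setIP[Gk]] := Sylow_Jsub sylSK sJgK pJg.
rewrite astab1inE // -conjsgM => /eqP vk sJkS.
have Gg' : g^-1 \in G by rewrite groupV.
have /fv : g^-1 * k \in 'N_G(J).
  by rewrite !inE groupM //= wcJ ?groupM.
rewrite actMin // => vgk.
have vg : to v g^-1 = v by apply: (act_inj to k); rewrite /= vgk vk.
by rewrite -[in LHS]vg actKVin.
Qed.

Lemma gact_orbit_partition v J : J \subset G ->
  partition [set orbit to J x | x in orbit to G v] (orbit to G v).
Proof.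
move=> sJG; apply: orbit_partition.
exact: subset_trans sJG (acts_orbit to v (subxx G)).
Qed.

(** The orbit condition may assume [v ^+ p \in 'C_(|to)(G)] because the induction on the order of
    [v] already covers [v ^+ p]. *)
Lemma fixed_points_control (p : nat) S J :
    p.-group D -> p.-Sylow(G) S -> weakly_closed J S G ->
    (forall v g, v \in 'C_(|to)('N_G(J)) -> v ^+ p \in 'C_(|to)(G) -> g \in G ->
      ~ {in J, forall b, to (to v g) b = to v g} ->
      val (\sum_(x in orbit to J (to v g)) fmod abelD x)%R \in 'C_(|to)(G)) ->
  'C_(|to)('N_G(J)) = 'C_(|to)(G).
Proof.
move=> pD sylS wcJ orbC; apply/eqP; rewrite eqEsubset.
rewrite [X in _ && X]gacentS ?subsetIl // andbT; apply/subsetP=> v.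
have [n] := ubnP #[v]; elim: n => // n IHn in v * => le_v_n Cv.
have [-> | ntv] := eqVneq v 1; first exact: group1.
have sJG := subset_trans wcJ.1 (pHall_sub sylS).
have [Dv fv] := gacentP v (subsetIl G 'N(J)) Cv.
have Cvp : v ^+ p \in 'C_(|to)(G).
  apply: IHn; last exact: groupX.
  have pv : p.-elt v := mem_p_elt pD Dv.
  have p_pr : prime p.
    by have /(pgroup_pdiv pv)[] : <[v]> != 1 by rewrite cycle_eq1.
  have dv : p %| #[v].
    by have /(pgroup_pdiv pv)[_ ->] : <[v]> != 1 by rewrite cycle_eq1.
  rewrite orderXdiv //; apply: leq_trans (_ : #[v] <= n); last exact: le_v_n.
  by rewrite ltn_Pdiv ?prime_gt1.
set Om := orbit to G v; pose f := fmod abelD.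
have sOmD : Om \subset D by apply: orbit_sub_range.
have CP : val (\sum_(x in Om) f x)%R \in 'C_(|to)(G).
  apply/gacentP=> //; split=> [|g Gg]; first exact: fmodP.
  apply: gact_sum_stable => // x Omx.
  by rewrite (acts_act (acts_orbit to v (subxx G))) //.
have fixE x : x \in Om -> {in J, forall b, to x b = x} -> x = v.
  by case/imsetP=> g Gg -> fJ; apply: weakly_closed_fixed_conjugate sylS wcJ Cv Gg fJ.
have fvJ : {in J, forall b, to v b = v}.
  by move=> b Jb; rewrite fv // inE (subsetP sJG) // (subsetP (normG J)).
have orbv : orbit to J v = [set v].
  by apply/orbit1P/afixP.
rewrite (set_partition_big _ (gact_orbit_partition v sJG)) /= in CP.
(* By [fixE], [[set v]] is the only [J]-orbit of length 1. Once the other orbits are known to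
   contribute elements of ['C_(|to)(G)], the factor [v] that remains lies there too. *)
rewrite (bigD1 [set v]) /= in CP; last first.
  by rewrite -orbv imset_f // orbit_refl.
rewrite big_set1 fmvalA fmodK // in CP.
rewrite groupMr // in CP.
pose K : pred (fmod_of abelD) := [pred u | val u \in 'C_(|to)(G)].
suff : K (\sum_(O in [set orbit to J x | x in Om] | O != [set v])
           \sum_(x in O) f x)%R by [].
apply: (big_ind K) => [|x y|O /andP[/imsetP[x Omx ->] ntx]].
- by rewrite /K /= fmval0 group1.
- by rewrite /K /= fmvalA; apply: groupM.
have /imsetP[g Gg Dx] := Omx; rewrite /K /= Dx.
apply: orbC => // fJ; case/eqP: ntx.
by rewrite (fixE x) // Dx.
Qed.

(** The [J]-orbit is the union of the [M]-orbit and its translate by [a]. These are disjoint: a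
    common point would give an element of [M :* a], up to factors in [M], that fixes [w], whereas
    the stabilizer lies in [M]. *)
Lemma sum_orbit_index2 J M a w :
    J \subset G -> M \subset J -> #|J : M| = 2 -> a \in J -> a \notin M ->
    {in J, forall b, to w b = w -> b \in M} ->
  (\sum_(x in orbit to J w) fmod abelD x
    = \sum_(x in orbit to M w) (fmod abelD x + fmod abelD (to x a)))%R.
Proof.
move=> sJG sMJ iJM Ja nMa stM; have Ga := subsetP sJG a Ja.
have sMG := subset_trans sMJ sJG.
pose Oa := [set to x a | x in orbit to M w].
have defO : orbit to J w = orbit to M w :|: Oa.
  apply/setP=> x; rewrite inE; apply/imsetP/orP=> [[b Jb ->] | []].
  - have [Mb | nMb] := boolP (b \in M); first by left; apply: mem_orbit.
    right; have /rcosetP[m Mm ->] : b \in M :* a.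
      by rewrite -(index2_rcoset sMJ iJM Ja nMa) inE nMb.
    rewrite actMin ?(subsetP sMG m) //.
    by apply: imset_f; apply: mem_orbit.
  - by case/imsetP=> m Mm ->; exists m => //; apply: (subsetP sMJ).
  case/imsetP=> _ /imsetP[m Mm ->] ->; exists (m * a).
    by rewrite groupM // (subsetP sMJ m).
  by rewrite actMin ?(subsetP sMG m).
have dO : [disjoint orbit to M w & Oa].
  rewrite -setI_eq0; apply/eqP/setP=> x; rewrite !inE; apply/negbTE/negP.
  case/andP=> /imsetP[m Mm ->] /imsetP[_ /imsetP[n Mn ->]] Dm.
  have Gm := subsetP sMG m Mm; have Gn := subsetP sMG n Mn.
  have fw : to w (n * a * m^-1) = w.
    by rewrite !actMin ?groupM ?groupV // -Dm actKin.
  have /stM/(_ fw) : n * a * m^-1 \in J.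
    by rewrite groupMr ?groupV ?(subsetP sMJ m) // groupMl ?(subsetP sMJ n).
  by rewrite groupMr ?groupV // groupMl // (negPf nMa).
have -> : (\sum_(x in orbit to J w) fmod abelD x
          = \sum_(x in [predU orbit to M w & Oa]) fmod abelD x)%R.
  by apply: eq_bigl => x; rewrite defO !inE.
rewrite bigU //= big_split /=; congr (_ + _)%R.
by rewrite [LHS]big_imset // => x y _ _; apply: act_inj.
Qed.

(** * Conjugation, generated families and weak closure *)

Lemma gactJ_comm x a g :
  a \in G -> g \in G -> to (to x g) (a ^ g) = to (to x a) g.
Proof. by move=> Ga Gg; rewrite -!actMin ?groupJ // -conjgC. Qed.

Lemma fam_gen_sub (F : {set {group aT}}) (H : {group aT}) :
  (fam_gen F \subset H) = [forall B in F, B \subset H].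
Proof.
by rewrite gen_subG; apply/bigcupsP/forall_inP.
Qed.

Lemma mem_fam_gen (F : {set {group aT}}) (B : {group aT}) :
  B \in F -> B \subset fam_gen F.
Proof. by move=> FB; apply/sub_gen/bigcup_sup. Qed.

Lemma fam_gen_in_sub (F : {set {group aT}}) S : fam_gen (fam_in F S) \subset S.
Proof. by rewrite fam_gen_sub; apply/forall_inP=> B; rewrite inE => /andP[]. Qed.

(** If the conjugate by [g] lies in [S], then each generator [B] has [B :^ g] again in the family
    and inside [S], so the conjugate is contained in the original and has the same order. *)
Lemma weakly_closed_fam_gen (F : {set {group aT}}) S :
    (forall (B : {group aT}) g, g \in G -> B \in F -> (B :^ g)%G \in F) ->
  weakly_closed (fam_gen (fam_in F S)) S G.
Proof.
move=> Fcl; split=> [|g Gg sJgS]; first exact: fam_gen_in_sub.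
apply/eqP; rewrite eqEcard cardJg leqnn andbT sub_conjg.
rewrite (fam_gen_sub _ (fam_gen_group (fam_in F S) :^ g^-1)).
apply/forall_inP=> B FSB; have := FSB; rewrite inE => /andP[FB sBS].
rewrite -sub_conjg; apply: (@mem_fam_gen _ (B :^ g)%G); rewrite inE Fcl //=.
by apply: subset_trans sJgS; rewrite conjSg mem_fam_gen.
Qed.

(** [M] is a maximal subgroup above the stabilizer of [w]; it has index 2 in a 2-group, and some
    generator must escape it. *)
Lemma unfixed_maximal (F : {set {group aT}}) w :
    2.-group (fam_gen F) -> ~ {in fam_gen F, forall b, to w b = w} ->
    fam_gen F \subset G ->
  exists M : {group aT},
    [/\ M \subset fam_gen F, #|fam_gen F : M| = 2,
        {in fam_gen F, forall b, to w b = w -> b \in M}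
      & exists2 B : {group aT}, B \in F & ~~ (B \subset M)].
Proof.
move=> pJ nfJ sJG; set J := fam_gen_group F.
have [defJ | [M maxM sCM]] := maximal_exists (subsetIl J 'C[w | to]).
  case: nfJ => b; rewrite -[fam_gen F]/(gval J) -defJ => /setIP[Jb].
  by rewrite astab1inE ?(subsetP sJG) // => /eqP.
have sMJ : M \subset J by case/maxgroupP: maxM => /andP[].
exists M; split=> //; first exact: p_maximal_index pJ maxM.
  move=> b Jb fb; apply: (subsetP sCM).
  by rewrite inE Jb astab1inE ?fb ?(subsetP sJG) /=.
have := proper_subn (maxgroupp maxM); rewrite /J /= fam_gen_sub.
by case/forall_inPn=> B FB nBM; exists B.
Qed.

Lemma gacentJ A g : A \subset G -> g \in G ->
  'C_(|to)(A :^ g) = [set to x g | x in 'C_(|to)(A)].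
Proof.
move=> sAG Gg.
have sAgG : A :^ g \subset G by rewrite conj_subG.
have Gg' : g^-1 \in G by rewrite groupV.
apply/setP=> x; apply/(gacentP _ sAgG)/imsetP=> [[Dx fx] | [y /gacentP[] // Dy fy ->]].
  exists (to x g^-1); last by rewrite actKVin.
  apply/gacentP=> //; split=> [|a Aa]; first exact: gact_mem.
  have Ga := subsetP sAG a Aa.
  rewrite -[in RHS](fx (a ^ g)) ?memJ_conjg // -[in RHS](actKVin to Gg x).
  by rewrite gactJ_comm // actKin.
split=> [|_ /imsetP[a Aa ->]]; first exact: gact_mem.
by rewrite gactJ_comm ?(subsetP sAG a) // fy.
Qed.

Lemma offenderJ (p : nat) A g :
  g \in G -> offender to p A -> offender to p (A :^ g)%G.
Proof.
move=> Gg /and4P[sAG pA abA oA]; apply/and4P; split=> /=.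
- by rewrite conj_subG.
- by rewrite pgroupJ.
- by rewrite abelianJ.
rewrite cardJg gacentJ // card_in_imset // => x y _ _; exact: act_inj.
Qed.

Definition conj_class A : {set {group aT}} := [set (A :^ g)%G | g in G].

Lemma conj_classJ A B g :
  g \in G -> B \in conj_class A -> (B :^ g)%G \in conj_class A.
Proof.
move=> Gg /imsetP[h Gh ->]; apply/imsetP; exists (h * g); first exact: groupM.
by apply/val_inj; rewrite /= conjsgM.
Qed.

Lemma conj_class_gen_neq1 (p : nat) A S :
    p.-Sylow(G) S -> A \subset G -> p.-group A -> A :!=: 1 ->
  fam_gen (fam_in (conj_class A) S) != 1.
Proof.
move=> sylS sAG pA ntA; have [g Gg sAgS] := Sylow_Jsub sylS sAG pA.
apply: contraNneq ntA => J1.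
have : (A :^ g)%G \in fam_in (conj_class A) S by rewrite inE imset_f.
by move/mem_fam_gen; rewrite J1 subG1 /= => /eqP Ag1; rewrite -(conjsgK g A) Ag1 conjs1g.
Qed.

(* For such an [A], the norm from [A0] to [A] is squaring on [C_D(A0)]. *)
Lemma rigid_subgroup_control A S :
    2.-Sylow(G) S -> 2.-group D -> A \subset G ->
    (forall A0 : {group aT}, A0 \subset A -> #|A : A0| = 2 ->
       'C_(|to)(A0) \subset 'C_(|to)(A)) ->
  'C_(|to)('N_G(fam_gen (fam_in (conj_class A) S))) = 'C_(|to)(G).
Proof.
move=> sylS pD sAG rigA; set J := fam_gen _.
have sJS : J \subset S by apply: fam_gen_in_sub.
have sJG : J \subset G := subset_trans sJS (pHall_sub sylS).
have pJ : 2.-group J := pgroupS sJS (pHall_pgroup sylS).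
have wcJ : weakly_closed J S G.
  by apply: weakly_closed_fam_gen => B g Gg; apply: conj_classJ.
rewrite -[J]/(gval (fam_gen_group _)).
apply: (fixed_points_control pD sylS wcJ) => v g Cv Cv2 Gg nfJ.
have [Dv _] := gacentP v (subsetIl G 'N(J)) Cv.
have [M [sMJ iJM stM [B FB nBM]]] := unfixed_maximal pJ nfJ sJG.
have /subsetPn[a Ba nMa] := nBM.
have Ja : a \in J := subsetP (mem_fam_gen FB) a Ba.
have sMG := subset_trans sMJ sJG.
have Dw : to v g \in D by rewrite gact_mem.
rewrite (sum_orbit_index2 sJG sMJ iJM Ja nMa stM) big_split /=.
set O := orbit to M _.
have sOD : O \subset D by apply: orbit_sub_range.
pose y := val (\sum_(x in O) fmod abelD x)%R.
have Dy : y \in D by apply: fmodP.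
have fMy : {in M, forall m, to y m = y}.
  move=> m Mm; apply: gact_sum_stable => //; first exact: (subsetP sMG).
  by move=> x Ox; rewrite (acts_act (acts_orbit to _ sMG)).
(* The product [y] of the [M]-orbit is fixed by [B :&: M], of index 2 in the conjugate [B] of [A].
   Rigidity, transported by conjugation, makes it fixed by [B], hence by [a]. *)
have ya : to y a = y.
  have sBG : B \subset G := subset_trans (mem_fam_gen FB) sJG.
  have iBM := index2_capg (mem_fam_gen FB) iJM nBM.
  move: FB; rewrite inE => /andP[/imsetP[h Gh defB] _].
  pose A0 := ((B :&: M) :^ h^-1)%G.
  have sA0A : A0 \subset A by rewrite /A0 /= sub_conjgV defB /= subsetIl.
  have sA0G := subset_trans sA0A sAG.
  have rigA0 : 'C_(|to)(A0) \subset 'C_(|to)(A).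
    apply: rigA sA0A _; rewrite -(indexJg _ _ h) /A0 /= conjsgKV -iBM.
    by rewrite {2}defB.
  have /(gacentP _ sBG)[_ fy] : y \in 'C_(|to)(B); last exact: fy.
  rewrite defB gacentJ // (subsetP (imsetS _ rigA0)) // -gacentJ //.
  rewrite /A0 /= conjsgKV; apply/gacentP; first by rewrite subIset ?sBG.
  by split=> // m /setIP[_]; apply: fMy.
(* The two halves now have the same product, so the total is the product of the squares of the
   points of [O], each equal to [v ^+ 2]. *)
rewrite fmvalA -gact_sum ?(subsetP sJG) // ya.
rewrite /y -fmvalA -big_split /=.
apply: (big_ind (fun u : fmod_of abelD => val u \in 'C_(|to)(G))).
- by rewrite fmval0 group1.
- by move=> u1 u2; rewrite fmvalA; apply: groupM.
move=> _ /imsetP[m Mm ->]; have Gm := subsetP sMG m Mm.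
rewrite fmvalA fmodK ?gact_mem // -[_ * _]/(_ ^+ 2) -!gactX ?gact_mem //.
by have [_ fv2] := gacentP _ (subxx G) Cv2; rewrite !fv2.
Qed.

(** * Transvections *)

Hypotheses (pD : 2.-group D) (ffG : [faithful G, on D | to]).

Lemma faithful_eq1 a : a \in G -> {in D, forall d, to d a = d} -> a = 1.
Proof.
move=> Ga fa; apply/set1P/(subsetP ffG); rewrite inE Ga /= !inE Ga.
by apply/subsetP=> d Dd; rewrite inE fa.
Qed.

(* [a] acts as [d |-> d * z ^ phi d] for a homomorphism [phi : D -> Z/2]. *)
Definition transvection a z : bool :=
  [&& a \in G, a != 1, z \in D
    & [forall d in D, (to d a == d) || (to d a == d * z)]].

Lemma transvectionP a z :
  reflect [/\ a \in G, a <> 1, z \in D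
            & {in D, forall d, to d a <> d -> to d a = d * z}]
          (transvection a z).
Proof.
apply: (iffP and4P) => [[Ga nta Dz /forall_inP az] | [Ga nta Dz az]].
  split=> // [|d Dd]; first exact/eqP.
  by have /orP[/eqP | /eqP] := az d Dd.
split=> //; first exact/eqP.
by apply/forall_inP=> d Dd; case: eqP => //= fd; rewrite az.
Qed.

Section OneTransvection.

Variables (a : aT) (z : rT).
Hypothesis tv_a : transvection a z.

Lemma transvG : a \in G. Proof. by case/transvectionP: tv_a. Qed.
Lemma transvD : z \in D. Proof. by case/transvectionP: tv_a. Qed.
Hint Resolve transvG transvD : core.

Lemma transv_moved d : d \in D -> to d a <> d -> to d a = d * z.
Proof. by case/transvectionP: tv_a => _ _ _; apply. Qed.

Lemma transv_moves : exists2 d, d \in D & to d a <> d.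
Proof.
have [/exists_inP[d Dd /eqP] | /exists_inPn fa] :=
  boolP [exists d in D, to d a != d]; first by exists d.
case/transvectionP: tv_a => Ga nta _ _; case: nta; apply: faithful_eq1 => // d Dd.
by apply/eqP/negPn/fa.
Qed.

Lemma transv_center_neq1 : z <> 1.
Proof.
have [d Dd nfd] := transv_moves.
by move=> z1; case: (nfd); rewrite transv_moved // z1 mulg1.
Qed.

(** For a moved [d], the image of [d * d] is [d * d * (z * z)]. Either [d * d] is fixed, or
    [z * z = z], which would force [z = 1]. *)
Lemma transv_center_sq : z * z = 1.
Proof.
have [d Dd nfd] := transv_moves.
have dd : to (d * d) a = d * d * (z * z).
  rewrite gactM // transv_moved // -!mulgA; congr (_ * _).
  by rewrite [z * (d * z)]mulgA [z * d](centsP abelD) ?mulgA.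
have [fdd | /eqP] := eqVneq (to (d * d) a) (d * d).
  by apply: (mulgI (d * d)); rewrite mulg1 -dd.
move/(transv_moved (groupM Dd Dd)); rewrite dd => /mulgI/(congr1 (mulg z^-1)).
by rewrite mulKg mulVg => /transv_center_neq1.
Qed.

Lemma transv_center_fixed : to z a = z.
Proof.
have [// | /eqP/(transv_moved transvD)] := eqVneq (to z a) z.
rewrite transv_center_sq -(gact1 to transvG) => /act_inj.
by move/transv_center_neq1.
Qed.

Lemma transv_involution : a * a = 1.
Proof.
apply: faithful_eq1 => [|d Dd]; first exact: groupM.
rewrite actMin //; have [fd | /eqP nfd] := eqVneq (to d a) d; first by rewrite !fd.
rewrite (transv_moved Dd nfd) gactM // transv_center_fixed (transv_moved Dd nfd).
by rewrite -mulgA transv_center_sq mulg1.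
Qed.

(** Two shifts by [z] cancel. Equality of booleans serves as addition in Z/2, with [true] as 0, so
    this is the additivity of [phi]. *)
Lemma transv_fixedM d e : d \in D -> e \in D ->
  (to (d * e) a == d * e) = ((to d a == d) == (to e a == e)).
Proof.
move=> Dd De; rewrite gactM //.
have [-> | /eqP nfd] := eqVneq (to d a) d; have [-> | /eqP nfe] := eqVneq (to e a) e.
- by rewrite !eqxx.
- by apply/eqP=> /mulgI.
- by apply/eqP=> /mulIg.
have zez : z * (e * z) = e.
  by rewrite (centsP abelD z _ (e * z)) ?groupM // -mulgA transv_center_sq mulg1.
by rewrite (transv_moved Dd nfd) (transv_moved De nfe) -mulgA zez !eqxx.
Qed.

Lemma order_transv : #[a] = 2.
Proof.
apply/nt_prime_order=> //; first exact: transv_involution.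
by case/transvectionP: tv_a => _ /eqP.
Qed.

(** Translation by a moved point exchanges fixed and moved points. *)
Lemma card_transv_fixed : (#|'C_(|to)(<[a]>)| * 2 = #|D|)%N.
Proof.
set C := 'C_(|to)(_); have sCD : C \subset D := subsetIl _ _.
have [d Dd nfd] := transv_moves.
have fixC x : x \in D -> (x \in C) = (to x a == x).
  by move=> Dx; rewrite /C gacent_cycle ?gacent1E ?transvG // inE Dx; apply/afix1P/eqP.
have moved_inv : (to d^-1 a == d^-1) = false.
  have := transv_fixedM Dd (groupVr Dd); rewrite mulgV gact1 // eqxx.
  by move/eqP: nfd => /negPf->; case: eqP.
rewrite -[RHS](cardsID C) (setIidPr sCD) muln2 -addnn; congr (_ + _)%N.
rewrite -(card_rcoset C d^-1); apply: eq_card => x; rewrite in_setD mem_rcoset invgK.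
have [Dx | nDx] := boolP (x \in D); last first.
  rewrite andbF; apply/negbTE; apply: contra nDx.
  by move=> /(subsetP sCD); rewrite groupMr.
rewrite andbT !fixC ?groupM // transv_fixedM //.
by move/eqP: nfd => /negPf->; case: (to x a == x).
Qed.

End OneTransvection.

(** * Transvections as offenders of order 2 *)

Lemma transv_center_inj a z y : transvection a z -> transvection a y -> z = y.
Proof.
move=> tv_z tv_y; have [d Dd mvd] := transv_moves tv_z.
by apply: (mulgI d); rewrite -(transv_moved tv_z) // (transv_moved tv_y).
Qed.

Lemma transv_best_offender a z :
  transvection a z -> <[a]>%G \in best_offenders2 to 2.
Proof.
move=> tv_a; have Ga := transvG tv_a; have oa := order_transv tv_a.
rewrite !inE -orderE oa eqxx andbT /= cycle_eq1 -order_eq1 oa andbT.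
rewrite /best_offender cycle_subG Ga cycle_abelian /pgroup -orderE oa /=.
apply/forall_inP=> B sBA; rewrite [X in _ <= X]mulnC (card_transv_fixed tv_a).
have := cardSg sBA; rewrite -orderE oa dvdn_divisors // !inE => /orP[] /eqP oB.
  by rewrite oB mul1n subset_leq_card ?subsetIl.
have -> : B :=: <[a]> by apply/eqP; rewrite eqEcard sBA -orderE oa oB.
by rewrite -orderE oa mulnC (card_transv_fixed tv_a).
Qed.

Lemma transvJ a z g :
  transvection a z -> g \in G -> transvection (a ^ g) (to z g).
Proof.
move=> tv_a Gg; case/transvectionP: (tv_a) => Ga nta Dz mva.
have Gg' : g^-1 \in G by rewrite groupV.
apply/transvectionP; split; rewrite ?groupJ ?gact_mem //.
  by move/eqP; rewrite conjg_eq1 => /eqP.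
move=> d Dd; rewrite -{1 2 3}(actKVin to Gg d) gactJ_comm // => mvd.
rewrite mva ?gact_mem //; first by rewrite gactM ?gact_mem // actKVin.
by move=> fd; case: mvd; rewrite fd.
Qed.

Lemma transv_of_order2 A :
    A \subset G -> #|A| = 2 -> #|D| <= 2 * #|'C_(|to)(A)| ->
  exists a z, transvection a z /\ A :=: <[a]>.
Proof.
move=> sAG oA oD.
have [a Aa nta] : exists2 a, a \in A & a != 1.
  by apply/trivgPn; rewrite trivg_card1 oA.
have defA : A :=: <[a]>.
  apply/esym/eqP; rewrite eqEcard cycle_subG Aa oA -orderE order_gt1 //.
have Ga := subsetP sAG a Aa.
set C := 'C_(|to)(A) in oD.
have sCD : C \subset D := subsetIl _ _.
have fixC x : x \in D -> (x \in C) = (to x a == x).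
  move=> Dx; rewrite /C defA gacent_cycle // gacent1E // inE Dx.
  exact/afix1P/eqP.
have [d Dd nCd] : exists2 d, d \in D & d \notin C.
  apply/subsetPn; apply: contra nta => sDC; apply/eqP/faithful_eq1 => // d Dd.
  by apply/eqP; rewrite -fixC // (subsetP sDC).
have iDC : #|D : C| = 2.
  apply/eqP; rewrite eqn_leq ltn_neqAle eq_sym indexg_eq1 indexg_gt0 andbT.
  rewrite -(leq_pmul2l (cardG_gt0 (gacent_group to A))) Lagrange // mulnC oD.
  by apply: contra nCd => /subsetP->.
(* The moved points form the single coset [C :* d], and [a] fixes [C], so all of them are shifted by
   the commutator of [d] and [a]. *)
exists a, (d^-1 * to d a); split=> //; apply/transvectionP; split=> //.
- exact/eqP.
- by rewrite groupM ?groupV ?gact_mem.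
move=> x Dx /eqP; rewrite -fixC // => nCx.
have /rcosetP[c Cc ->] : x \in C :* d.
  by rewrite -(index2_rcoset sCD iDC Dd nCd) inE nCx.
have Dc := subsetP sCD c Cc.
rewrite gactM // -mulgA mulKVg; congr (_ * _).
by apply/eqP; rewrite -fixC.
Qed.

Lemma best_offender2_transv A : A \in best_offenders2 to 2 ->
  exists a z, transvection a z /\ A :=: <[a]>.
Proof.
rewrite !inE => /andP[/andP[/and4P[sAG _ _ /forall_inP bestA] _] /eqP oA].
apply: transv_of_order2 => //; rewrite -oA.
(* Comparison with the trivial subgroup turns a best offender into an offender. *)
by have := bestA 1%G (sub1G _); rewrite gacent1 cards1 mul1n.
Qed.

(* Two transvections with the same axis [C_D(a) = C_D(b)] generate a rigid
   four-group (see [rigid_of_equal_axes]), which is why this may be assumed. *)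
Section DistinctAxes.

Hypothesis transv_axis_inj : forall a b y z,
  transvection a z -> transvection b y ->
  {in D, forall d, (to d a == d) = (to d b == d)} -> a = b.

Lemma transv_fixedJ a z b y d : transvection a z -> transvection b y -> d \in D ->
  (to d (a ^ b) == d) = (to (to d b) a == to d b).
Proof.
move=> tv_a tv_b Dd; have Ga := transvG tv_a; have Gb := transvG tv_b.
have b2 := transv_involution tv_b.
have b' : b^-1 = b by apply: (mulgI b); rewrite mulgV.
have bK x : to (to x b) b = x by rewrite -actMin // b2 act1.
rewrite conjgE b' !actMin ?groupM //.
by apply/eqP/eqP=> [e | ->]; [apply: (act_inj to b); rewrite /= e bK | rewrite bK].
Qed.

(** If [a] fixes the center [y] of [b], shifting by [y] does not affect being fixed by [a], so
    [a ^ b] and [a] have the same axis. *)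
Lemma transv_commute a z b y : transvection a z -> transvection b y ->
  to y a = y -> a ^ b = a.
Proof.
move=> tv_a tv_b ya; have Ga := transvG tv_a; have Gb := transvG tv_b.
apply: (transv_axis_inj (transvJ tv_a Gb) tv_a) => d Dd.
rewrite (transv_fixedJ tv_a tv_b) //.
have [-> // | /eqP mvd] := eqVneq (to d b) d.
by rewrite (transv_moved tv_b) // (transv_fixedM tv_a) ?(transvD tv_b) // ya eqxx eqb_id.
Qed.

Lemma transv_commute_fixed a z b y : transvection a z -> transvection b y ->
  a ^ b = a -> to y a = y.
Proof.
move=> tv_a tv_b cab; have Ga := transvG tv_a; have Gb := transvG tv_b.
have Dy := transvD tv_b; have [d Dd mvd] := transv_moves tv_b.
have Dda : to d a \in D by rewrite gact_mem.
have : to (to d b) a = to (to d a) b by rewrite -{1}cab gactJ_comm.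
rewrite (transv_moved tv_b Dd mvd) gactM //.
have [-> | /eqP mvda] := eqVneq (to (to d a) b) (to d a).
  rewrite -[RHS]mulg1 => /mulgI; rewrite -(gact1 to Ga) => /act_inj.
  by move/(transv_center_neq1 tv_b).
by rewrite (transv_moved tv_b Dda mvda) => /mulgI.
Qed.

(** Each of [a], [b] moves the center of the other, so the axis of [a ^ b] is the kernel of the sum
    of the two homomorphisms to Z/2. This is symmetric in [a] and [b]. *)
Lemma transv_braid a z b y : transvection a z -> transvection b y ->
  a ^ b <> a -> a ^ b = b ^ a.
Proof.
move=> tv_a tv_b ncab; have Ga := transvG tv_a; have Gb := transvG tv_b.
have yP : (to y a == y) = false.
  by apply/eqP=> ya; case: ncab; apply: (transv_commute tv_a tv_b).
have zP : (to z b == z) = false.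
  apply/eqP=> zb; case: ncab; have := transv_commute tv_b tv_a zb.
  by move/conjg_fixP/commgP/commute_sym/commgP/conjg_fixP.
apply: (transv_axis_inj (transvJ tv_a Gb) (transvJ tv_b Ga)) => d Dd.
rewrite (transv_fixedJ tv_a tv_b) // (transv_fixedJ tv_b tv_a) //.
have fixE c u e x : transvection c u -> transvection e x -> (to u e == u) = false ->
    (to (to d c) e == to d c) = ((to d e == d) == (to d c == d)).
  move=> tv_c tv_e ue; have [-> | /eqP mv] := eqVneq (to d c) d; first by rewrite eqb_id.
  by rewrite (transv_moved tv_c Dd mv) (transv_fixedM tv_e Dd (transvD tv_c)) ue.
by rewrite (fixE b y a z) // (fixE a z b y) // eq_sym.
Qed.

(** Otherwise [x] is moved by both [a] and [b], hence fixed by [a * b], which is again a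
    transvection with center [z]. Then [c] commutes with [a * b] and so fixes [z], which makes it
    commute with [a]. *)
Lemma transv_same_center a b z c x :
    transvection a z -> transvection b z -> transvection c x ->
    a <> b -> a ^ b = a -> a ^ c = a.
Proof.
move=> tv_a tv_b tv_c neq_ab cab; apply/eqP; apply: contraT => /eqP ncac.
have Ga := transvG tv_a; have Gb := transvG tv_b; have Gc := transvG tv_c.
have cC e f : e ^ f = e -> f ^ e = f :> aT.
  by move/conjg_fixP/commgP/commute_sym/commgP/conjg_fixP.
have Dx := transvD tv_c.
have mz : to z c <> z by move=> zc; apply/ncac/cC/(transv_commute tv_c tv_a zc).
have mxa : to x a <> x by move=> xa; apply/ncac/(transv_commute tv_a tv_c xa).
have mxb : to x b <> x.
  move=> xb; apply: mz; apply: (transv_commute_fixed tv_c tv_b).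
  exact: (cC _ _ (transv_commute tv_b tv_c xb)).
have tv_ab : transvection (a * b) z.
  apply/transvectionP; split; rewrite ?groupM ?(transvD tv_a) //.
    move=> ab1; apply: neq_ab; apply: (mulIg b).
    by rewrite ab1 (transv_involution tv_b).
  move=> d Dd; rewrite actMin //.
  have [-> | /eqP mda] := eqVneq (to d a) d; first exact: transv_moved.
  rewrite (transv_moved tv_a Dd mda) gactM ?(transvD tv_a) //.
  rewrite (transv_center_fixed tv_b).
  have [-> // | /eqP mdb] := eqVneq (to d b) d.
  by rewrite (transv_moved tv_b Dd mdb) -mulgA (transv_center_sq tv_a) mulg1.
apply/eqP; case: mz; apply: (transv_commute_fixed tv_c tv_ab); apply: cC.
apply: (transv_commute tv_ab tv_c); rewrite actMin //.
rewrite (transv_moved tv_a Dx mxa) gactM ?(transvD tv_a) //.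
rewrite (transv_center_fixed tv_b) (transv_moved tv_b Dx mxb) -mulgA.
by rewrite (transv_center_sq tv_a) mulg1.
Qed.

Lemma order_transvM a z b y : transvection a z -> transvection b y ->
  a ^ b <> a -> #[a * b] = 3.
Proof.
move=> tv_a tv_b ncab; apply: nt_prime_order => //.
  have a' : a^-1 = a by apply: (mulgI a); rewrite mulgV (transv_involution tv_a).
  have b' : b^-1 = b by apply: (mulgI b); rewrite mulgV (transv_involution tv_b).
  have := transv_braid tv_a tv_b ncab; rewrite !conjgE a' b' => braid.
  have aK (t : aT) : a * (a * t) = t by rewrite mulgA (transv_involution tv_a) mul1g.
  have bK (t : aT) : b * (b * t) = t by rewrite mulgA (transv_involution tv_b) mul1g.
  by rewrite !expgS expg0 mulg1 -!mulgA braid aK bK (transv_involution tv_a).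
apply/eqP=> ab1; apply: ncab.
have -> : a = b by apply: (mulIg b); rewrite ab1 (transv_involution tv_b).
by rewrite conjgE mulKg.
Qed.

Lemma transv_commute_2group (P : {group aT}) a z b y :
    transvection a z -> transvection b y -> 2.-group P -> a \in P -> b \in P ->
  a ^ b = a.
Proof.
move=> tv_a tv_b pP Pa Pb; apply/eqP; apply: contraT => /eqP ncab.
have := mem_p_elt pP (groupM Pa Pb).
by rewrite /p_elt (order_transvM tv_a tv_b ncab).
Qed.

(** The witness is [L], generated by [a] and [b]. The other transvections in [S] commute with [a],
    lying in a common 2-group, and with [b] by assumption; this gives (S2). For (S3), the commutator
    of [D] and [L] is generated by the two centers. *)
Lemma solitary_of_pair S a z b y :
    2.-Sylow(G) S -> transvection a z -> a \in S -> transvection b y ->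
    a ^ b <> a ->
    (forall c x, transvection c x -> c \in S -> c <> a -> c ^ b = c) ->
  solitary_wrt to S <[a]>%G.
Proof.
move=> sylS tv_a Sa tv_b ncab comb.
have Ga := transvG tv_a; have Gb := transvG tv_b.
have Dz := transvD tv_a; have Dy := transvD tv_b.
have pS := pHall_pgroup sylS.
rewrite /solitary_wrt; set AS := fam_in _ _; set J0 := fam_gen AS.
pose T := <[a]>%G; pose R := fam_gen_group (AS :\ T).
pose L := <<[set a; b]>>%G.
have ASP B : B \in AS -> exists c x, [/\ transvection c x, c \in S & B :=: <[c]>].
  rewrite inE => /andP[/best_offender2_transv[c [x [tv_c ->]]]].
  by rewrite cycle_subG => Sc; exists c, x.
have AST : T \in AS by rewrite inE (transv_best_offender tv_a) cycle_subG.
rewrite AST /=; apply/existsP; exists L.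
have sLG : L \subset G by rewrite gen_subG subUset !sub1set Ga.
have La : a \in L by rewrite mem_gen ?set21.
have Lb : b \in L by rewrite mem_gen ?set22.
have sJ0S : J0 \subset S by apply: fam_gen_in_sub.
have sRJ0 : R \subset J0.
  rewrite (fam_gen_sub _ (fam_gen_group AS)); apply/forall_inP=> B.
  by rewrite inE => /andP[_ /mem_fam_gen].
have sRC : R \subset 'C_J0(L).
  rewrite subsetI sRJ0 (fam_gen_sub _ 'C(L)); apply/forall_inP=> B.
  rewrite in_setD1 => /andP[neqBT /ASP[c [x [tv_c Sc defB]]]].
  rewrite defB cycle_subG /= cent_gen -sub_cent1 subUset !sub1set.
  have -> : a \in 'C[c].
    apply/cent1P/commute_sym/commgP/conjg_fixP.
    exact: transv_commute_2group tv_c tv_a pS Sc Sa.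
  apply/cent1P/commute_sym/commgP/conjg_fixP; apply: comb tv_c Sc _ => ca.
  by case/eqP: neqBT; apply/val_inj; rewrite /= defB ca.
have sTJ0 : T \subset J0 := mem_fam_gen AST.
have nCa : T :&: 'C_J0(L) = 1.
  apply: prime_TIg; first by rewrite -orderE (order_transv tv_a).
  rewrite cycle_subG inE; apply/negP=> /andP[_ /centP/(_ b Lb) cab].
  by apply/ncab/conjg_fixP/commgP.
have cTC : 'C_J0(L) \subset 'C(T).
  by rewrite subIset // centS ?orbT // cycle_subG.
have defTR : T * R = J0.
  apply/eqP; rewrite eqEsubset mul_subG //=.
  have cTR : R \subset 'C(T) := subset_trans sRC cTC.
  rewrite -cent_joinEr // fam_gen_sub; apply/forall_inP=> B ASB.
  have [-> | neqBT] := eqVneq B T; first exact: joing_subl.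
  by apply: subset_trans (joing_subr _ _); apply: mem_fam_gen; rewrite in_setD1 neqBT.
(* By orders: the direct product of [T] and ['C_J0(L)] lies in [J0], which is already [T * R]. *)
have defR : 'C_J0(L) = R.
  apply/esym/eqP; rewrite eqEcard sRC /= -(leq_pmul2l (cardG_gt0 T)).
  rewrite -!TI_cardMg ?defTR ?subset_leq_card ?mul_subG ?subsetIl //.
  by apply/trivgP; rewrite -nCa setIS.
have defTC : T \x 'C_J0(L) = J0 by rewrite dprodE //; apply: etrans defTR; congr (_ * _).
have mza : (to y a == y) = false.
  by apply/eqP=> ya; apply/ncab/(transv_commute tv_a tv_b).
have myb : (to z b == z) = false.
  apply/eqP=> zb; apply: ncab.
  by have /conjg_fixP/commgP/commute_sym/commgP/conjg_fixP := transv_commute tv_b tv_a zb.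
have fza := transv_center_fixed tv_a; have fyb := transv_center_fixed tv_b.
pose W := <<[set z; y]>>%G.
have sWD : W \subset D by rewrite gen_subG subUset !sub1set Dz.
have sKW : act_comm to D L \subset W.
  (* [X] collects the elements that keep every coset of [W] in [D]. It is a group, so only the
     generators [a] and [b] of [L] need testing. *)
  pose X := [set l in G | [forall d in D, d^-1 * to d l \in W]].
  have XP l : reflect (l \in G /\ {in D, forall d, d^-1 * to d l \in W}) (l \in X).
    by rewrite inE; apply: (iffP andP) => -[-> /forall_inP].
  have gX : group_set X.
    apply/group_setP; split=> [|l m /XP[Gl Wl] /XP[Gm Wm]]; apply/XP; split.
    - exact: group1.
    - by move=> d Dd; rewrite act1 mulVg group1.
    - exact: groupM.
    move=> d Dd; rewrite actMin // -[d^-1](mulgKV (to d l)^-1) invgK -mulgA.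
    by rewrite groupM ?Wl ?Wm ?gact_mem.
  have tvX c x : transvection c x -> x \in W -> c \in X.
    move=> tv_c Wx; apply/XP; split=> [|d Dd]; first exact: transvG tv_c.
    have [-> | /eqP mvd] := eqVneq (to d c) d; first by rewrite mulVg group1.
    by rewrite (transv_moved tv_c) // mulKg.
  have sLX : L \subset Group gX.
    rewrite gen_subG subUset !sub1set /= (tvX a z) ?(tvX b y) //.
      by rewrite mem_gen ?set22.
    by rewrite mem_gen ?set21.
  rewrite gen_subG; apply/subsetP=> _ /imset2P[d l Dd Ll ->].
  by have /XP[_ ->] := subsetP sLX l Ll.
(* Each center is a commutator with the other one: [a] shifts [y] by [z], and [b] shifts [z] by
   [y]. *)
have [Kz Ky] : z \in act_comm to D L /\ y \in act_comm to D L.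
  split; apply/mem_gen/imset2P.
    by exists y a => //; rewrite (transv_moved tv_a) ?mulKg //; apply/eqP; rewrite mza.
  by exists z b => //; rewrite (transv_moved tv_b) ?mulKg //; apply/eqP; rewrite myb.
have CLP d : d \in D -> (d \in 'C_(|to)(L)) = (to d a == d) && (to d b == d).
  move=> Dd; rewrite gacent_gen ?subUset ?sub1set ?Ga //.
  apply/gacentP/andP; first by rewrite subUset !sub1set Ga.
    by case=> _ fd; rewrite !fd ?set21 ?set22.
  by case=> /eqP fa /eqP fb; split=> // _ /set2P[]->.
have defD : act_comm to D L \x 'C_(|to)(L) = D.
  rewrite dprodE.
  - apply/eqP; rewrite eqEsubset mul_subG ?(subset_trans sKW) ?subsetIl //=.
    apply/subsetP=> d Dd.
    (* One of [1], [z], [y], [z * y] is moved by exactly those of [a], [b] that move [d]; dividing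
       [d] by it leaves a point fixed by [L]. *)
    have [w [Kw Dw wa wb]] : exists w, [/\ w \in act_comm to D L, w \in D,
        (to w a == w) = (to d a == d) & (to w b == w) = (to d b == d)].
      case: (to d a == d); case: (to d b == d).
      + by exists 1; rewrite !group1 !gact1 // eqxx.
      + by exists z; rewrite fza eqxx.
      + by exists y; rewrite fyb eqxx.
      exists (z * y); rewrite !groupM // (transv_fixedM tv_a) // (transv_fixedM tv_b) //.
      by rewrite fza fyb mza myb !eqxx.
    rewrite -(mulKVg w d) mem_mulg // CLP ?groupM ?groupV //.
    rewrite (transv_fixedM tv_a) ?groupV // (transv_fixedM tv_b) ?groupV //.
    have VE c : c \in G -> (to w^-1 c == w^-1) = (to w c == w).
      by move=> Gc; rewrite gactV //; apply/eqP/eqP=> [/invg_inj|->].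
    by rewrite !VE // wa wb !eqxx.
  - by rewrite subIset // (subset_trans abelD) // centS // (subset_trans sKW).
  apply/trivgP/subsetP=> w /setIP[/(subsetP sKW) Ww CLw]; apply/set1P.
  have Dw := subsetP sWD w Ww.
  move: CLw; rewrite CLP //.
  have /mulsgP[u v] : w \in <[z]> * <[y]>.
    rewrite -cent_joinEr ?(subsetP _ w Ww) //.
      rewrite gen_subG subUset !sub1set mem_gen ?inE ?cycle_id //.
      by rewrite mem_gen ?inE ?cycle_id ?orbT.
    by rewrite (sub_abelian_cent2 abelD) ?cycle_subG.
  have ord2 x : x * x = 1 -> x != 1 -> #[x] = 2 by move=> *; apply: nt_prime_order.
  rewrite !cycle2g ?ord2 ?(transv_center_sq tv_a) ?(transv_center_sq tv_b) //.
  - move=> /set2P[]-> /set2P[]-> ->; rewrite ?mul1g ?mulg1 ?mza ?myb ?andbF //.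
    by rewrite (transv_fixedM tv_a) // fza mza eqxx.
  - by apply/eqP/transv_center_neq1; apply: tv_b.
  by apply/eqP/transv_center_neq1; apply: tv_a.
have KC : act_comm to (act_comm to D L) 'C_J0(L) = 1.
  apply/trivgP; rewrite gen_subG; apply/subsetP=> _ /imset2P[w c Kw Cc ->].
  have /setIP[Jc CLc] := Cc.
  have Gc : c \in G := subsetP (pHall_sub sylS) c (subsetP sJ0S c Jc).
  (* Conjugation by [c] fixes [e], and a transvection determines its center. *)
  have fix_center e x : transvection e x -> e \in L -> to x c = x.
    move=> tv_e Le; have := transvJ tv_e Gc.
    have -> : e ^ c = e.
      by apply/conjg_fixP/commgP/commute_sym; apply: (centP CLc).
    by move/(transv_center_inj tv_e).
  have /subsetP/(_ w (subsetP sKW w Kw)) : W \subset 'C_(|to)([set c]).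
    rewrite gen_subG subUset !sub1set; apply/andP.
    split; apply/gacentP; rewrite ?sub1set //; split=> // _ /set1P->.
      exact: fix_center tv_a La.
    exact: fix_center tv_b Lb.
  case/gacentP=> [|_ fw]; first by rewrite sub1set.
  by rewrite fw ?set11 // mulVg set11.
apply/and5P; split=> //; first by rewrite cycle_subG.
  apply: S3_Sym; rewrite ?(order_transv tv_a) ?(order_transv tv_b) //.
  exact: order_transvM tv_a tv_b ncab.
  exact/eqP.
by apply/and3P; split; apply/eqP.
Qed.

(** * Classes of transvections *)

Section ClassOfTransvection.

Variables (S : {group aT}) (t : aT) (u : rT).
Hypotheses (sylS : 2.-Sylow(G) S) (tv_t : transvection t u).
Let Gt := transvG tv_t.

Let J := fam_gen_group (fam_in (conj_class <[t]>) S).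

Lemma mem_conj_class_cycle (B : {group aT}) :
  reflect (exists2 h, h \in G & B :=: <[t ^ h]>) (B \in conj_class <[t]>).
Proof.
apply: (iffP imsetP) => -[h Gh defB]; exists h => //.
  by rewrite defB /= cycleJ.
by apply/val_inj; rewrite /= defB cycleJ.
Qed.

Lemma class_gen_mem h : h \in G -> t ^ h \in S -> t ^ h \in J.
Proof.
move=> Gh Sth; rewrite -cycle_subG; apply: (@mem_fam_gen _ <[t ^ h]>%G).
by rewrite inE cycle_subG Sth andbT; apply/mem_conj_class_cycle; exists h.
Qed.

Lemma class_gen_subPn (H : {group aT}) : ~~ (J \subset H) ->
  exists h, [/\ h \in G, t ^ h \in S & t ^ h \notin H].
Proof.
rewrite fam_gen_sub => /forall_inPn[B]; rewrite inE.
case/andP=> /mem_conj_class_cycle[h Gh ->]; rewrite !cycle_subG => Sth nHth.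
by exists h.
Qed.

(** If [a] commuted with all conjugates of [t] in [S :^ g], then [a ^ g^-1] would centralize [J] and
    so fix [v], and [a] would fix [to v g]. *)
Lemma class_noncommuting a v g : a \in G -> g \in G ->
    v \in 'C_(|to)('N_G(J)) -> to (to v g) a <> to v g ->
  exists h, [/\ h \in G, t ^ h \in S :^ g & a ^ (t ^ h) <> a].
Proof.
move=> Ga Gg Cv mva; have Gg' : g^-1 \in G by rewrite groupV.
have [|h [Gh Sth]] := @class_gen_subPn ('C[a] :^ g^-1)%G.
  apply/negP=> sJC; apply: mva.
  have [_ fv] := gacentP v (subsetIl G 'N(J)) Cv.
  have NJa : a ^ g^-1 \in 'N_G(J).
    rewrite inE groupJ // (subsetP (cent_sub J)) //; apply/centP=> j Jj.
    have := subsetP sJC j Jj; rewrite mem_conjgV => /cent1P caj.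
    by apply: (conjg_inj g); rewrite [LHS]conjMg [RHS]conjMg conjgKV.
  by rewrite -{1}(conjgKV g a) gactJ_comm ?groupJ // fv.
rewrite mem_conjgV => /cent1P nca.
exists (h * g); rewrite conjgM memJ_conjg; split=> //; first exact: groupM.
by move/conjg_fixP/commgP/commute_sym.
Qed.

Lemma transv_class_control : <[t]>%G \notin solitary_subgroups to ->
  'C_(|to)('N_G(J)) = 'C_(|to)(G).
Proof.
move=> nsolT.
have sJS : J \subset S by apply: fam_gen_in_sub.
have sSG : S \subset G := pHall_sub sylS.
have sJG : J \subset G := subset_trans sJS sSG.
have pS : 2.-group S := pHall_pgroup sylS.
have pJ : 2.-group J := pgroupS sJS pS.
have wcJ : weakly_closed J S G.
  by apply: weakly_closed_fam_gen => B g Gg; apply: conj_classJ.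
apply: (fixed_points_control pD sylS wcJ) => v g Cv Cv2 Gg nfJ.
have [Dv fv] := gacentP v (subsetIl G 'N(J)) Cv.
have [M [sMJ iJM stM [B FB nBM]]] := unfixed_maximal pJ nfJ sJG.
move: FB nBM; rewrite inE => /andP[/mem_conj_class_cycle[h Gh ->]].
rewrite !cycle_subG => Sa nMa.
have tv_a := transvJ tv_t Gh; have Ja := class_gen_mem Gh Sa.
set a := t ^ h in Sa nMa tv_a Ja; set z := to u h in tv_a.
have Ga := transvG tv_a; have Dz := transvD tv_a.
have sMG := subset_trans sMJ sJG.
have Dw : to v g \in D by rewrite gact_mem.
have mwa : to (to v g) a <> to v g.
  by move=> fa; case/negP: nMa; apply: stM.
have cJa : J \subset 'C[a].
  apply: contraT => /class_gen_subPn[k [Gk Sk]] /cent1P[].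
  apply/commute_sym/commgP/conjg_fixP.
  exact: transv_commute_2group tv_a (transvJ tv_t Gk) pS Sa Sk.
rewrite (sum_orbit_index2 sJG sMJ iJM Ja nMa stM).
set O := orbit to M (to v g).
(* Each pair [x, to x a] contributes [x ^+ 2 * z]. *)
have OP x : x \in O -> x \in D /\ to x a = x * z.
  case/imsetP=> m Mm ->; have Gm := subsetP sMG m Mm.
  have Dwm : to (to v g) m \in D by apply: gact_mem.
  split=> //; apply: (transv_moved tv_a) => //.
  have /cent1P cma := subsetP cJa m (subsetP sMJ m Mm).
  by rewrite -actMin // cma actMin // => /act_inj.
have -> : (\sum_(x in O) (fmod abelD x + fmod abelD (to x a))
          = \sum_(x in O) fmod abelD (x ^+ 2) + fmod abelD z *+ #|O|)%R.
  rewrite -GRing.sumr_const -big_split /=; apply: eq_bigr => x /OP[Dx ->].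
  by rewrite -!fmodM ?groupX ?groupM // mulgA.
rewrite fmvalA groupMl; last first.
  apply: (big_ind (fun f : fmod_of abelD => val f \in 'C_(|to)(G))).
  - by rewrite fmval0 group1.
  - by move=> f1 f2; rewrite fmvalA; apply: groupM.
  move=> x /imsetP[m Mm ->]; have Gm := subsetP sMG m Mm.
  have Dx : to (to v g) m \in D by apply: gact_mem.
  rewrite fmodK; last exact: groupX.
  rewrite -!gactX ?gact_mem //.
  by have [_ fv2] := gacentP _ (subxx G) Cv2; rewrite !fv2.
rewrite fmvalZ fmodK //.
have /p_natP[k oO] : 2.-nat #|O|.
  rewrite card_orbit_in // (pnat_dvd (dvdn_indexg _ _)) //.
  exact: pgroupS sMJ pJ.
(* When [O] has even length, the contribution [z ^+ #|O|] is trivial. *)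
case: k oO => [|k] oO; last first.
  by rewrite oO expnS expgM [z ^+ 2](transv_center_sq tv_a) expg1n group1.
(* The [J]-orbit has length 2: [<[a]>] turns out to be solitary. *)
have fMw : {in M, forall m, to (to v g) m = to v g}.
  move=> m Mm; have := mem_orbit to (to v g) Mm.
  by rewrite (card_orbit1 oO) => /set1P.
(* A second class member outside [M] would send [to v g] to the same point as [a], since [M] fixes
   [to v g], and so share its center. By [transv_same_center], [a] would then commute with the whole
   class, against [class_noncommuting]. *)
have class_M k : k \in G -> t ^ k \in S -> t ^ k <> a -> t ^ k \in M.
  move=> Gk Sb neq_ba; apply: contraT => nMb.
  have tv_b := transvJ tv_t Gk; have Jb := class_gen_mem Gk Sb.
  have mwb : to (to v g) (t ^ k) <> to v g.
    by move=> fb; case/negP: nMb; apply: stM.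
  have /rcosetP[m Mm Db] : t ^ k \in M :* a.
    by rewrite -(index2_rcoset sMJ iJM Ja nMa) inE nMb.
  have eq_zy : z = to u k.
    apply: (mulgI (to v g)); rewrite -(transv_moved tv_a) // -(transv_moved tv_b) //.
    by rewrite Db [RHS]actMin ?(subsetP sMG m) // (fMw m Mm).
  rewrite -eq_zy in tv_b.
  have [l [Gl _ []]] := class_noncommuting Ga Gg Cv mwa.
  apply: (transv_same_center tv_a tv_b (transvJ tv_t Gl)); first exact: nesym.
  exact: transv_commute_2group tv_a tv_b pS Sa Sb.
(* Sylow in the stabilizer of [to v g] yields [k] there with [M] inside [S :^ (g * k)]. That Sylow
   subgroup then contains some [b] in the class of [t] not commuting with [a]. *)
have sSgC : (S :^ g)%G \subset 'C_G[to v g | to].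
  apply/subsetP=> _ /imsetP[s Ss ->]; have Gs := subsetP sSG s Ss.
  have NJs := subsetP (weakly_closed_sub_norm sSG wcJ) s Ss.
  by rewrite inE groupJ // astab1inE ?groupJ // gactJ_comm // (fv s NJs) eqxx.
have sylSg : 2.-Sylow(G) (S :^ g) by rewrite pHallJ.
have sMC : M \subset 'C_G[to v g | to].
  by apply/subsetP=> m Mm; rewrite inE astab1inE (subsetP sMG) //= fMw.
have [k /setIP[Gk]] := Sylow_subJ (pHall_subl sSgC (subsetIl _ _) sylSg) sMC
  (pgroupS sMJ pJ).
rewrite astab1inE // -conjsgM -actMin // => /eqP wgk sMS.
have Ggk : g * k \in G by apply: groupM.
have [|l [Gl Sb ncab]] := class_noncommuting Ga Ggk Cv; first by rewrite wgk.
have tv_b := transvJ tv_t Gl; set b := t ^ l in Sb ncab tv_b.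
have Gb := transvG tv_b.
(* Failing to commute, [c] would be conjugate to [b] by the braid relation, hence in the class of
   [t] and so in [M]. But then [b] and [c] lie in a common 2-group. *)
have comb c x : transvection c x -> c \in S -> c <> a -> c ^ b = c.
  move=> tv_c Sc neq_ca; apply/eqP; apply: contraT => /eqP nccb.
  have Dc : c = t ^ (l * (c * b^-1)).
    by rewrite conjgM conjgM -/b -(transv_braid tv_c tv_b nccb) conjgK.
  have Mc : c \in M.
    have Gc := transvG tv_c.
    by rewrite Dc class_M -?Dc // !groupM ?groupV.
  case: nccb; apply: (transv_commute_2group tv_c tv_b) Sb.
    by rewrite pgroupJ.
  exact: (subsetP sMS).
have Gh' : h^-1 \in G by rewrite groupV.
(* Since [a] is [t ^ h], conjugating the configuration back by [h^-1] makes [t] itself solitary. *)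
case/negP: nsolT; rewrite inE; apply/existsP; exists (S :^ h^-1)%G.
rewrite pHallJ // sylS /=.
apply: (solitary_of_pair _ tv_t _ (transvJ tv_b Gh')).
- by rewrite pHallJ.
- by rewrite mem_conjgV.
- by move/(congr1 (conjg^~ h)); rewrite conjJg conjgKV.
move=> c x tv_c; rewrite mem_conjgV => Sc neq_ct.
apply: (conjg_inj h); rewrite conjJg conjgKV.
apply: comb (transvJ tv_c Gh) Sc _ => /conjg_inj; exact: neq_ct.
Qed.

End ClassOfTransvection.

End DistinctAxes.

(** * Rigid offenders *)

Definition rigid_offender A : bool :=
  [&& offender to 2 A, A :!=: 1
    & [forall B : {group aT}, (B \subset A) && (#|A : B| == 2) ==>
         ('C_(|to)(B) \subset 'C_(|to)(A))]].

(** The product [a * b] shifts moved points by [z * y], which is not 1 as [a] and [b] differ. So all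
    three involutions of the four-group have the same fixed points, and so does every subgroup of
    index 2. *)
Lemma rigid_of_equal_axes a b y z :
    transvection a z -> transvection b y -> a <> b ->
    {in D, forall d, (to d a == d) = (to d b == d)} ->
  rigid_offender (<[a]> <*> <[b]>).
Proof.
move=> tv_a tv_b neq_ab eqfix.
have Ga := transvG tv_a; have Gb := transvG tv_b.
have Dz := transvD tv_a; have Dy := transvD tv_b.
have za : to y a = y by apply/eqP; rewrite eqfix // (transv_center_fixed tv_b).
have yb : to z b = z by apply/eqP; rewrite -eqfix // (transv_center_fixed tv_a).
have abE d : d \in D -> to d a <> d -> to d (a * b) = d * (z * y).
  move=> Dd mda; have mdb : to d b <> d by move/eqP; rewrite -eqfix // => /eqP.
  rewrite actMin // (transv_moved tv_a Dd mda) gactM // yb.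
  rewrite (transv_moved tv_b Dd mdb) -!mulgA; congr (_ * _).
  exact: (centsP abelD).
have zy2 : z * y * (z * y) = 1.
  rewrite [z * y](centsP abelD) // -mulgA [z * (y * z)](centsP abelD) ?groupM //.
  by rewrite -[y * z * z]mulgA (transv_center_sq tv_a) mulg1 (transv_center_sq tv_b).
have neq_zy : z * y != 1.
  apply/eqP=> zy1; have [d Dd mda] := transv_moves tv_a.
  apply: neq_ab; apply: (mulIg b); rewrite (transv_involution tv_b).
  apply: faithful_eq1 => [|x Dx]; first exact: groupM.
  have [fa | /eqP mxa] := eqVneq (to x a) x; last by rewrite abE // zy1 mulg1.
  by rewrite actMin // fa; apply/eqP; rewrite -eqfix // fa.
have cab : commute a b.
  have abab : a * b * (a * b) = 1.
    apply: faithful_eq1 => [|d Dd]; first by rewrite !groupM.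
    rewrite actMin ?groupM //; have [fa | /eqP mda] := eqVneq (to d a) d.
      have fab : to d (a * b) = d.
        by rewrite actMin // fa; apply/eqP; rewrite -eqfix // fa.
      by rewrite !fab.
    have fzy : to (z * y) (a * b) = z * y.
      rewrite actMin // gactM // (transv_center_fixed tv_a) za gactM // yb.
      by rewrite (transv_center_fixed tv_b).
    rewrite (abE d Dd mda) gactM ?groupM // fzy (abE d Dd mda).
    by rewrite -mulgA zy2 mulg1.
  apply: (mulgI (a * b)); rewrite abab -mulgA [b * (b * a)]mulgA.
  by rewrite (transv_involution tv_b) mul1g (transv_involution tv_a).
have sub_cent : <[b]> \subset 'C(<[a]>) by rewrite cents_cycle.
have fixM (e : aT) d : d \in D -> e \in <[a]> <*> <[b]> -> e != 1 ->
    (to d e == d) = (to d a == d).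
  move=> Dd; rewrite cent_joinEr // => /mulsgP[i j].
  rewrite /= !cycle2g ?(order_transv tv_a) ?(order_transv tv_b) //.
  move=> /set2P[]-> /set2P[]-> ->; rewrite ?mul1g ?mulg1 ?eqxx // => _.
    by rewrite eqfix.
  have [fa | /eqP mda] := eqVneq (to d a) d.
    by rewrite actMin // fa -eqfix // fa eqxx.
  by rewrite abE // -{2}[d]mulg1 (inj_eq (mulgI d)) (negPf neq_zy).
have sAG : <[a]> <*> <[b]> \subset G by rewrite join_subG !cycle_subG Ga.
have fixC (e : aT) d : d \in D -> e \in <[a]> <*> <[b]> -> e != 1 -> to d e = d ->
    d \in 'C_(|to)(<[a]> <*> <[b]>).
  move=> Dd Ae nte de; apply/gacentP=> //; split=> // f Af; apply/eqP.
  have [-> | ntf] := eqVneq f 1; first by rewrite act1.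
  by rewrite (fixM f) // -(fixM e) // de.
have oA : #|<[a]> <*> <[b]>| = 4.
  rewrite cent_joinEr // TI_cardMg -?orderE ?(order_transv tv_a) ?(order_transv tv_b) //.
  apply: prime_TIg; first by rewrite -orderE (order_transv tv_a).
  rewrite cycle_subG /= cycle2g ?(order_transv tv_b) //; apply/set2P=> -[a1 | //].
  by case/transvectionP: tv_a.
apply/and3P; split.
- apply/and4P; split=> //.
  + by rewrite /pgroup oA.
  + by rewrite /= abelianY !cycle_abelian.
  rewrite oA -(card_transv_fixed tv_a) mulnC leq_mul // subset_leq_card //.
  apply/subsetP=> d /gacentP[|Dd fd]; first by rewrite cycle_subG.
  apply: (fixC a) => //; last by rewrite fd ?cycle_id.
    by rewrite mem_gen // inE cycle_id.
  by rewrite -order_gt1 (order_transv tv_a).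
- by rewrite -cardG_gt1 oA.
apply/forall_inP=> B /andP[sBA]; move/eqP=> iB.
have oB : (#|B| * 2 = 4)%N by rewrite -oA -(Lagrange sBA) iB.
have [e Be nte] : exists2 e, e \in B & e != 1.
  apply/trivgPn; rewrite trivg_card1 neq_ltn; apply/orP; right.
  by rewrite -(ltn_pmul2r (isT : 0 < 2)) oB.
apply/subsetP=> d /gacentP[|Dd fd]; first exact: subset_trans sBA sAG.
by apply: (fixC e) => //; [apply: (subsetP sBA) | apply: fd].
Qed.

(** A subgroup [B] of index 2 is nontrivial and by minimality no offender. Comparing the two
    inequalities gives ['C_(|to)(A)] index less than 2 in ['C_(|to)(B)]. *)
Lemma rigid_of_minimal A :
    min_nontrivial_offender to 2 A -> #|A| != 2 -> rigid_offender A.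
Proof.
case/mingroupP=> /andP[offA ntA] minA oA2; rewrite /rigid_offender offA ntA /=.
have /and4P[sAG pA abA oD] := offA.
apply/forall_inP=> B /andP[sBA /eqP iAB].
have sCC : 'C_(|to)(A) \subset 'C_(|to)(B) := gacentS to sBA.
have ntB : B :!=: 1.
  by apply: contraNneq oA2 => B1; rewrite -(Lagrange sBA) iAB B1 cards1.
have ltBD : #|B| * #|'C_(|to)(B)| < #|D|.
  rewrite ltnNge; apply/negP=> oBD; case/eqP: oA2.
  have defB : B :=: A.
    apply: (minA _ _ sBA); rewrite ntB andbT; apply/and4P; split=> //.
    - exact: subset_trans sBA sAG.
    - exact: pgroupS sBA pA.
    - exact: abelianS sBA abA.
  by move: iAB; rewrite defB indexgg.
have := leq_trans ltBD oD; rewrite -(Lagrange sBA) iAB -mulnA ltn_pmul2l //.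
rewrite -(@Lagrange _ (gacent_group to B) (gacent_group to A) sCC) mulnC ltn_pmul2r //.
by rewrite ltnS leq_eqVlt ltnS leqn0 -[_ == 0]negbK -lt0n indexg_gt0 orbF indexg_eq1.
Qed.

(** * Assembly of the two cases *)

Lemma control_witness A S : 2.-Sylow(G) S -> offender to 2 A -> A :!=: 1 ->
    'C_(|to)('N_G(fam_gen (fam_in (conj_class A) S))) = 'C_(|to)(G) ->
  exists J : {group aT},
    [/\ J :!=: 1,
        (exists2 F : {set {group aT}},
           {in F, forall A : {group aT}, offender to 2 A} & J :=: fam_gen F),
        weakly_closed J S G
      & 'C_(|to)('N_G(J)) = 'C_(|to)(G)].
Proof.
move=> sylS offA ntA conJ; have /and4P[sAG pA _ _] := offA.
exists (fam_gen_group (fam_in (conj_class A) S)); split=> //.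
- exact: conj_class_gen_neq1 sylS sAG pA ntA.
- exists (fam_in (conj_class A) S) => // B.
  by rewrite inE => /andP[/imsetP[g Gg ->] _]; apply: offenderJ.
by apply: weakly_closed_fam_gen => B g; apply: conj_classJ.
Qed.

End GroupActionOnAbelian.

Theorem theorem1p3 (aT rT : finGroupType) (G S : {group aT}) (D : {group rT})
    (to : groupAction G D) :
  2.-Sylow(G) S ->
  abelian D -> 2.-group D ->
  [faithful G, on D | to] ->
  (exists2 A : {group aT}, min_nontrivial_offender to 2 A
                         & A \notin solitary_subgroups to) ->
  exists J : {group aT},
    [/\ J :!=: 1,
        (exists2 F : {set {group aT}},
           {in F, forall A : {group aT}, offender to 2 A} & J :=: fam_gen F),
        weakly_closed J S G
      & 'C_(|to)('N_G(J)) = 'C_(|to)(G)].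
Proof.
move=> sylS abelD pD ffG [A minA nsolA].
have [/existsP[B rigB] | /existsPn noRig] := boolP [exists B, rigid_offender to B].
  have /and3P[offB ntB /forall_inP rigP] := rigB.
  apply: (control_witness sylS offB ntB); have /andP[sBG _] := offB.
  apply: rigid_subgroup_control => // B0 sB0 iB0.
  by apply: rigP; rewrite sB0 iB0.
have [/andP[offA ntA] _] := mingroupP minA.
have oA : #|A| = 2 by apply/eqP; apply: contraTT (noRig A) => /(rigid_of_minimal minA)->.
apply: (control_witness sylS offA ntA); have /and4P[sAG _ _ oD] := offA.
rewrite oA in oD; have [t [u [tv_t defA]]] := transv_of_order2 ffG sAG oA oD.
have {}defA : A = <[t]>%G by apply/val_inj.
rewrite defA in nsolA *; apply: (transv_class_control _ _ _ _ _ tv_t) => //.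
(* Distinct transvections with a common axis would generate a rigid offender, excluded in this
   case. *)
move=> a b y z tv_a tv_b eqfix; apply/eqP; apply: contraT => /eqP neq_ab.
have := noRig (<[a]> <*> <[b]>)%G.
by rewrite (rigid_of_equal_axes _ _ tv_a tv_b neq_ab eqfix).
Qed.
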